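(* Let $T$ be a Bauer affine theory. Then $T_{\mathrm{ext}}$ has affine reduction, and the models of $T_{\mathrm{ext}}$ are precisely the extremal models of $T$.
   Context: Affine logic is the fragment of continuous logic (convex continuity moduli) whose formulas are built from atomic formulas by real affine combinations and $\sup,\inf$; affine theories are sets of conditions between affine sentences. $S^{\mathrm{aff}}_n(T)$ is the compact convex set of affine types of $n$-tuples in models of $T$; its extreme points are the extreme types; a model of $T$ is extremal if all its finite tuples have extreme types. $T$ is a Bauer theory if each $S^{\mathrm{aff}}_n(T)$ is a Bauer simplex (a Choquet simplex whose extreme points form a closed set). $T_{\mathrm{ext}}$ is the common continuous logic theory of the extremal models of $T$. A continuous theory $Q$ has affine reduction if every continuous formula is, for each $\varepsilon>0$, within $\varepsilon$ modulo $Q$ of some affine formula. *)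

(* Defs.v *)
From HB Require Import structures.
From mathcomp Require Import all_boot all_order all_algebra.
From mathcomp Require Import all_classical all_reals all_analysis.

Set Implicit Arguments.
Unset Strict Implicit.
Unset Printing Implicit Defensive.

Import Order.TTheory GRing.Theory Num.Theory.
Import numFieldNormedType.Exports.

Local Open Scope classical_set_scope.
Local Open Scope ring_scope.

Definition extreme_points (R : realType) (E : lmodType R) (X : set E) : set E :=
  [set x | X x /\ forall y z (t : R), X y -> X z -> 0 < t < 1 ->
                    x = t *: y + (1 - t) *: z -> y = x /\ z = x].

(** The cone with base [X]; placing [X] at height 1 in [E * R] puts it in a
    hyperplane that misses the origin. *)
Definition cone_over (R : realType) (E : lmodType R) (X : set E) :
    set (E * R^o) :=
  [set v | exists r x, [/\ 0 <= r, X x & v = (r *: x, r)]].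

Definition span_cone (V : zmodType) (P : set V) : set V :=
  [set v | exists2 a, P a & exists2 b, P b & v = a - b].

Definition cone_le (V : zmodType) (P : set V) (u v : V) : Prop := P (v - u).

(** [P - P] is a lattice for the order whose positive cone is [P].  Joins are
    enough: meets are obtained from them through [v |-> - v]. *)
Definition lattice_cone (V : zmodType) (P : set V) : Prop :=
  forall u v, span_cone P u -> span_cone P v ->
  exists w, [/\ span_cone P w, cone_le P u w, cone_le P v w &
    forall z, span_cone P z -> cone_le P u z -> cone_le P v z -> cone_le P w z].

Definition choquet_simplex (R : realType) (E : preTopologicalLmodType R)
    (X : set E) : Prop :=
  [/\ compact X, convex_set (X : set (convex_lmodType E)) &
      lattice_cone (cone_over X)].

Definition bauer_simplex (R : realType) (E : preTopologicalLmodType R)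
    (X : set E) : Prop :=
  choquet_simplex X /\ closed (extreme_points X).

(** A continuity modulus in the inverse form: [delta e] is the distance between
    arguments that guarantees values within [e].  For a map [f] this is required
    below as [delta (d (f a) (f b)) <= \sum_i d (a i) (b i)].  It is for convex
    [delta] that this requirement is a set of affine conditions. *)
Definition convex_modulus (R : realType) (delta : R -> R) : Prop :=
  [/\ delta 0 = 0, forall e, 0 < e -> 0 < delta e &
      convex_function (`[0, +oo[ : set (convex_lmodType R^o)) delta].

Record language (R : realType) := Language {
  fsym : Type;
  psym : Type;
  farity : fsym -> nat;
  parity : psym -> nat;
  fmod : fsym -> R -> R;
  pmod : psym -> R -> R;
  pbound : psym -> R;
  diam : R;
  fmod_convex : forall f, convex_modulus (fmod f);
  pmod_convex : forall P, convex_modulus (pmod P)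
}.

Record structure (R : realType) (L : language R) := Structure {
  carrier :> metricType R;
  carrier_inhabited : inhabited carrier;
  carrier_complete : forall F : set_system carrier,
    ProperFilter F -> cauchy F -> exists x : carrier, F --> x;
  fint : forall f : fsym L, ('I_(farity f) -> carrier) -> carrier;
  pint : forall P : psym L, ('I_(parity P) -> carrier) -> R;
  mdist_diam : forall x y : carrier, mdist x y <= diam L;
  pint_bound : forall P a, `|@pint P a| <= pbound P;
  fint_mod : forall f a b,
    fmod f (mdist (@fint f a) (@fint f b)) <= \sum_i mdist (a i) (b i);
  pint_mod : forall P a b,
    pmod P `|@pint P a - @pint P b| <= \sum_i mdist (a i) (b i)
}.

Inductive term (R : realType) (L : language R) (n : nat) : Type :=
| Var : 'I_n -> term L n
| App (f : fsym L) : ('I_(farity f) -> term L n) -> term L n.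

Definition connectives (R : realType) := forall k, set ('rV[R]_k -> R).

Definition continuous_connectives (R : realType) : connectives R :=
  fun k => [set u | continuous u].

Definition affine_connectives (R : realType) : connectives R :=
  fun k => [set u | exists (c : R) (a : 'I_k -> R),
                      forall x : 'rV[R]_k, u x = c + \sum_i a i * x ord0 i].

(** [formula L C n] is the type of formulas over [L] with connectives in [C] and
    with free variables indexed by ['I_n].  A quantifier binds the variable
    [ord0] of its body, and [lift ord0 i] in the body stands for [i]. *)
Inductive formula (R : realType) (L : language R) (C : connectives R) :
    nat -> Type :=
| Dist n : term L n -> term L n -> formula L C n
| Pred n (P : psym L) : ('I_(parity P) -> term L n) -> formula L C n
| Conn n k (u : 'rV[R]_k -> R) : C k u -> ('I_k -> formula L C n) ->
    formula L C n
| Sup n : formula L C n.+1 -> formula L C n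
| Inf n : formula L C n.+1 -> formula L C n.

Definition affine_formula (R : realType) (L : language R) :=
  formula L (@affine_connectives R).

Definition continuous_formula (R : realType) (L : language R) :=
  formula L (@continuous_connectives R).

Definition extend (X : Type) n (x : X) (a : 'I_n -> X) : 'I_n.+1 -> X :=
  fun i => oapp a x (unlift ord0 i).

Fixpoint teval (R : realType) (L : language R) (M : structure L) n
    (a : 'I_n -> M) (t : term L n) : M :=
  match t with
  | Var i => a i
  | App f s => fint (fun i => teval a (s i))
  end.

Fixpoint feval (R : realType) (L : language R) (C : connectives R)
    (M : structure L) n (phi : formula L C n) : ('I_n -> M) -> R :=
  match phi with
  | Dist n s t => fun a => mdist (teval a s) (teval a t)
  | Pred n P s => fun a => pint (fun i => teval a (s i))
  | Conn n k u _ psi => fun a => u (\row_i feval (psi i) a)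
  | Sup n psi => fun a => sup (range (fun x => feval psi (extend x a)))
  | Inf n psi => fun a => inf (range (fun x => feval psi (extend x a)))
  end.

(** The pair [(phi, psi)] stands for the condition [phi <= psi]. *)
Definition condition (R : realType) (L : language R) (C : connectives R) : Type :=
  formula L C 0 * formula L C 0.

Definition satisfies (R : realType) (L : language R) (C : connectives R)
    (M : structure L) (c : condition L C) : Prop :=
  forall a : 'I_0 -> M, feval c.1 a <= feval c.2 a.

Definition theory (R : realType) (L : language R) (C : connectives R) : Type :=
  set (condition L C).

Definition affine_theory (R : realType) (L : language R) :=
  theory L (@affine_connectives R).

Definition continuous_theory (R : realType) (L : language R) :=
  theory L (@continuous_connectives R).

Definition is_model (R : realType) (L : language R) (C : connectives R)
    (T : theory L C) (M : structure L) : Prop :=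
  forall c, T c -> satisfies M c.

(** Real functions on affine formulas, with the topology of pointwise
    convergence. *)
Definition type_space (R : realType) (L : language R) (n : nat) : Type :=
  {ptws affine_formula L n -> R^o}.

HB.instance Definition _ (R : realType) (L : language R) (n : nat) :=
  Topological.on (type_space L n).
HB.instance Definition _ (R : realType) (L : language R) (n : nat) :=
  GRing.Lmodule.copy (type_space L n) (affine_formula L n -> R^o).

Definition affine_type (R : realType) (L : language R) (M : structure L) n
    (a : 'I_n -> M) : type_space L n :=
  fun phi => feval phi a.

Definition affine_types (R : realType) (L : language R) (T : affine_theory L)
    (n : nat) : set (type_space L n) :=
  [set p | exists (M : structure L) (a : 'I_n -> M),
             is_model T M /\ p = affine_type a].

Arguments affine_types {R L} T n _.

Definition bauer_theory (R : realType) (L : language R) (T : affine_theory L) :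
    Prop :=
  forall n, bauer_simplex (affine_types T n).

Definition extremal_model (R : realType) (L : language R) (T : affine_theory L)
    (M : structure L) : Prop :=
  is_model T M /\
  forall n (a : 'I_n -> M), extreme_points (affine_types T n) (affine_type a).

Definition extremal_theory (R : realType) (L : language R)
    (T : affine_theory L) : continuous_theory L :=
  [set c | forall M, extremal_model T M -> satisfies M c].

Definition affine_reduction (R : realType) (L : language R)
    (Q : continuous_theory L) : Prop :=
  forall n (phi : continuous_formula L n) (e : R), 0 < e ->
  exists psi : affine_formula L n,
  forall (M : structure L) (a : 'I_n -> M), is_model Q M ->
    `|feval phi a - feval psi a| <= e.

(* Main.v *)
Require Import Defs.
From mathcomp Require Import all_boot all_order all_algebra.
From mathcomp Require Import all_classical all_reals all_analysis.
From mathcomp Require Import ring lra.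

(** For continuous [g], positive [h], and [K] a Bauer simplex with extreme
    boundary [Ext], say that [t] is near the integral of [g] at a point [z] of
    the cone over [K] if [z] has a finite decomposition in the cone all of whose
    refinements give a Riemann sum of [g] within [h] of [t], relative to the
    height of [z].  Riesz decomposition, which is what the lattice order on the
    cone provides, gives any two decompositions a common refinement, so such a
    [t] is unique up to [2 h].  Near an extreme point [e] every decomposition is
    almost concentrated at [e], so [g e] is near the integral of [g] at all
    points of some compact convex neighbourhood of [e].  As [Ext] is compact,
    finitely many of these neighbourhoods cover it, and the convex hull [H] of
    their products with the values [g e] is a compact convex approximate graph.
    By uniqueness [0] is not a value of [(x - x', t - t' - c)] on [H * H], for a
    suitable multiple [c] of [h]; the functional that separates [0] from these
    values yields an affine combination of coordinates close to [g] on [Ext].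

    On a type space the coordinates are the affine formulas, so connectives can
    be eliminated one by one over the extremal models; quantifiers are
    harmless.  Bounds that hold in all extremal models are part of
    [extremal_theory T].  Hence affine reduction passes to its models, and so
    does extremality: since [Ext] is compact, a type outside it is kept away
    from it by finitely many formulas. *)

Set Implicit Arguments.
Unset Strict Implicit.
Unset Printing Implicit Defensive.

Import Order.TTheory GRing.Theory Num.Theory.
Import numFieldNormedType.Exports.

Local Open Scope classical_set_scope.
Local Open Scope ring_scope.

(** * Riesz decomposition *)

Section Riesz.
Variables (V : zmodType) (P : set V).
Hypothesis P0 : P 0.
Hypothesis PD : forall u v, P u -> P v -> P (u + v).
Hypothesis PN : forall v, P v -> P (- v) -> v = 0.
Hypothesis lattP : lattice_cone P.

Lemma cone_sum (I : Type) (r : seq I) (Q : pred I) (a : I -> V) :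
  (forall i, Q i -> P (a i)) -> P (\sum_(i <- r | Q i) a i).
Proof. by move=> Pa; elim/big_ind: _ => //; exact: PD. Qed.

(** The meet of [v] and [a] is the largest part of [v] that fits under [a]. The rest of [v] is the
    join minus [a], which lies below [b] because [a + b] bounds both [v] and [a]. *)
Lemma riesz_two v a b : P v -> P a -> P b -> P (a + b - v) ->
  exists v1 v2, [/\ P v1, P v2, v1 + v2 = v, P (a - v1) & P (b - v2)].
Proof.
move=> Pv Pa Pb Pabv.
have sP x : P x -> span_cone P x.
  by move=> Px; exists x => //; exists 0; rewrite ?subr0.
have [w [_ vw aw w_min]] := lattP (sP _ Pv) (sP _ Pa).
rewrite /cone_le in vw aw w_min.
(* [a + v - w] is the meet of [v] and [a]. *)
exists (a + v - w), (w - a); split=> //.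
- by apply: w_min; rewrite ?addrK ?(addrC a) ?addrK //; exact/sP/PD.
- by rewrite addrA subrK addrAC subrr add0r.
- by rewrite opprB addrCA opprD addNKr.
- rewrite opprB addrA (addrC b); apply: w_min => //; first exact/sP/PD.
  by rewrite addrAC subrr add0r.
Qed.

Lemma riesz_sum n (b : nat -> V) v :
  (forall j, (j < n)%N -> P (b j)) -> P v -> P (\sum_(j < n) b j - v) ->
  exists w : nat -> V,
    [/\ forall j, (j < n)%N -> P (w j),
        forall j, (j < n)%N -> P (b j - w j) & \sum_(j < n) w j = v].
Proof.
elim: n b v => [|n IHn] b v Pb Pv.
  rewrite big_ord0 sub0r => /(PN Pv) ->.
  by exists (fun=> 0); split=> //; rewrite big_ord0.
rewrite big_ord_recl /= => Pbv.
have Pb0 : P (b 0) by exact: Pb.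
have PbS : P (\sum_(i < n) b (bump 0 i)).
  by apply: cone_sum => i _; apply: Pb; rewrite /bump /= add1n ltnS.
have [v1 [v2 [Pv1 Pv2 <- Pbv1 Pbv2]]] := riesz_two Pv Pb0 PbS Pbv.
have [|w [Pw Pbw wE]] := IHn (fun i => b i.+1) v2 _ Pv2 Pbv2.
  by move=> j jn; exact: Pb.
exists (fun i => if i is i'.+1 then w i' else v1); split.
- by case=> // j jn; exact: Pw.
- by case=> // j jn; exact: Pbw.
- by rewrite big_ord_recl /= -wE.
Qed.

Lemma cone_sum_eq0 n (b : nat -> V) : (forall j, (j < n)%N -> P (b j)) ->
  \sum_(j < n) b j = 0 -> forall j, (j < n)%N -> b j = 0.
Proof.
move=> Pb b0 j jn; apply: PN; first exact: Pb.
move/eqP: b0; rewrite (bigD1 (Ordinal jn)) //= addr_eq0 => /eqP ->.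
by rewrite opprK; apply: cone_sum => i _; exact: Pb.
Qed.

(** Rows are split off one at a time: [riesz_sum] distributes [a 0] over the [b j], and the
    remainders [b j - w0 j] stay in the cone and sum to the other rows. *)
Lemma riesz_matrix n m (a b : nat -> V) :
  (forall i, (i < n)%N -> P (a i)) -> (forall j, (j < m)%N -> P (b j)) ->
  \sum_(i < n) a i = \sum_(j < m) b j ->
  exists w : nat -> nat -> V,
    [/\ forall i j, (i < n)%N -> (j < m)%N -> P (w i j),
        forall i, (i < n)%N -> \sum_(j < m) w i j = a i &
        forall j, (j < m)%N -> \sum_(i < n) w i j = b j].
Proof.
elim: n a b => [|n IHn] a b Pa Pb.
  rewrite big_ord0 => /esym b0; exists (fun _ _ => 0); split=> // j jm.
  by rewrite big_ord0 (cone_sum_eq0 Pb b0).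
rewrite big_ord_recl /= => ab.
have PaS : P (\sum_(i < n) a (bump 0 i)).
  by apply: cone_sum => i _; apply: Pa; rewrite /bump /= add1n ltnS.
have [|w0 [Pw0 Pbw0 w0E]] := riesz_sum Pb (Pa 0%N isT).
  by rewrite -ab addrAC subrr add0r.
have [i ilt|j jm||w [Pw wa wb]] := IHn (fun i => a i.+1) (fun j => b j - w0 j).
- exact: Pa.
- exact: Pbw0.
- by rewrite sumrB w0E -ab addrAC subrr add0r.
exists (fun i => if i is i'.+1 then w i' else w0); split.
- by case=> [|i] j ilt jm; [exact: Pw0|exact: Pw].
- by case=> // i ilt; exact: wa.
- by move=> j jm; rewrite big_ord_recl /= wb // addrC subrK.
Qed.

End Riesz.

(** * Compactness and separation *)

Lemma sum_sqr_gt0 (R : realDomainType) (I : Type) (s : seq I) (f : I -> R) :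
  0 < \sum_(i <- s) `|f i| -> 0 < \sum_(i <- s) f i * f i.
Proof.
elim: s => [|i s IHs]; rewrite ?big_nil // !big_cons.
have [-> |fi0 _] := eqVneq (f i) 0; first by rewrite normr0 mulr0 !add0r.
rewrite ltr_wpDr //; first by apply: sumr_ge0 => j _; rewrite -expr2 sqr_ge0.
by rewrite -expr2 exprn_even_gt0.
Qed.

Section Compactness.
Variables (R : realType) (X : topologicalType).

(** If [Q A] failed, the sets whose complement in [A] satisfies [Q] would form a proper filter
    containing [A], and a cluster point of it in [A] would contradict the local hypothesis. *)
Lemma compact_local_global (A : set X) (Q : set X -> Prop) : compact A ->
  Q set0 -> (forall B C, B `<=` C -> Q C -> Q B) ->
  (forall B C, Q B -> Q C -> Q (B `|` C)) ->
  (forall x, A x -> exists2 U, nbhs x U & Q (A `&` U)) -> Q A.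
Proof.
move=> cA Q0 QS QU Qloc; apply: contrapT => nQA.
pose F : set_system X := [set B | Q (A `\` B)].
have FF : ProperFilter F.
  split; first by rewrite /F /= setD0.
  split=> [|B C FB FC|B C BC]; rewrite /F /=.
  - by rewrite setDT.
  - by rewrite setDIr; exact: QU.
  - by apply: QS => x [Ax nCx]; split=> // /BC.
have [|p [Ap clp]] := cA F FF; first by rewrite /F /= setDv.
have [U Up QAU] := Qloc p Ap.
have FU : F (~` U) by rewrite /F /= setDE setCK.
by have [x []] := clp _ _ FU Up.
Qed.

(** By continuity a nonzero [D i] stays away from 0 near each point; to merge two pieces,
    concatenate the lists and take the smaller bound. *)
Lemma compact_finite_sep (I : Type) (P : set X) (D : I -> X -> R) : compact P ->
  (forall i, continuous (D i)) ->
  (forall p, P p -> exists i, D i p != 0) ->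
  exists (s : seq I) (d : R), 0 < d /\
    forall p, P p -> d <= \sum_(i <- s) `|D i p|.
Proof.
move=> cP cD D0.
pose Q (A : set X) := exists (s : seq I) (d : R), 0 < d /\
  forall p, A p -> d <= \sum_(i <- s) `|D i p|.
apply: (@compact_local_global P Q) => //.
- by exists [::], 1; split.
- by move=> B C BC [s [d [d0 sd]]]; exists s, d; split=> // p /BC; exact: sd.
- move=> B C [s [d [d0 sd]]] [s' [d' [d'0 sd']]].
  exists (s ++ s'), (Num.min d d'); split; first by rewrite lt_min d0.
  move=> p pBC; rewrite big_cat /=.
  have s0 r : 0 <= \sum_(i <- r) `|D i p| by apply: sumr_ge0.
  case: pBC => [/sd|/sd'] h; rewrite ge_min.
    by apply/orP; left; rewrite (le_trans h) // lerDl.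
  by apply/orP; right; rewrite (le_trans h) // lerDr.
- move=> x /D0[i Di]; pose d := `|D i x| / 2.
  have d0 : 0 < d by rewrite divr_gt0 // normr_gt0.
  exists [set y | d < `|D i y|]; last first.
    by exists [:: i], d; split=> // p [_ /ltW]; rewrite big_seq1.
  by apply: (cvgr_norm_gt (D i x) (cD i x)); rewrite /d; have := d0; rewrite /d; lra.
Qed.

Lemma continuous_sum_seq (I : Type) (s : seq I) (D : I -> X -> R) :
  (forall i, continuous (D i)) -> continuous (fun p => \sum_(i <- s) D i p).
Proof.
move=> cD; elim: s => [|i s IHs] x.
  rewrite (_ : (fun _ => _) = fun=> 0); last by apply/funext => p; rewrite big_nil.
  exact: cvg_cst.
rewrite (_ : (fun _ => _) = D i \+ (fun p => \sum_(i <- s) D i p)).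
  by apply: cvgD; [exact: cD|exact: IHs].
by apply/funext => p; rewrite big_cons.
Qed.

(** By [compact_finite_sep] finitely many coordinates already keep the image of [P] away from the
    origin. The functional is the scalar product with the image point of least Euclidean norm. *)
Lemma compact_convex_sep (I : Type) (P : set X) (D : I -> X -> R) : compact P ->
  (forall i, continuous (D i)) ->
  (forall p, P p -> exists i, D i p != 0) ->
  (forall p q (t : R), P p -> P q -> 0 <= t <= 1 ->
    exists2 r, P r & forall i, D i r = t * D i p + (1 - t) * D i q) ->
  exists (s : seq I) (a : I -> R),
    forall p, P p -> 0 < \sum_(i <- s) a i * D i p.
Proof.
move=> cP cD D0 mixP.
have [s [d [d0 sd]]] := compact_finite_sep cP cD D0.
have [->|/set0P P0] := eqVneq P set0; first by exists [::], (fun=> 0).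
pose N p := \sum_(i <- s) D i p * D i p.
have cN : continuous N.
  by apply: continuous_sum_seq => i x; apply: cvgM; exact: cD.
have cNP : {within P, continuous N} by exact: continuous_subspaceT.
have [p0 /set_mem Pp0 minp0] := compact_EVT_min P0 cP cNP.
have Np0 : 0 < N p0.
  by apply: sum_sqr_gt0; exact: lt_le_trans (sd _ Pp0).
(* Minimality of the norm at [p0] makes the scalar product of [D p0] and [D p]
   at least [N p0]. *)
exists s, (D^~ p0) => p Pp.
pose B := \sum_(i <- s) D i p0 * D i p.
have key (t : R) : 0 <= t <= 1 ->
    N p0 <= t ^+ 2 * N p + (2 * t * (1 - t)) * B + (1 - t) ^+ 2 * N p0.
  move=> t01; have [r Pr rE] := mixP _ _ t Pp Pp0 t01.
  have := minp0 r; rewrite inE => /(_ Pr) /le_trans; apply.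
  rewrite /N /B !mulr_sumr -!big_split /=; apply: ler_sum => i _.
  by rewrite rE le_eqVlt; apply/orP; left; apply/eqP; ring.
suff : N p0 <= B by exact: lt_le_trans.
rewrite leNgt; apply/negP => BN.
pose M := N p - 2 * B + N p0; pose a := N p0 - B.
have a0 : 0 < a by rewrite subr_gt0.
have M0 : 0 <= M.
  have -> : M = \sum_(i <- s) (D i p - D i p0) ^+ 2.
    rewrite /M /N /B mulr_sumr -sumrB -big_split /=.
    by apply: eq_bigr => i _; ring.
  by apply: sumr_ge0 => i _; exact: sqr_ge0.
have Ma0 : 0 < M + a by rewrite ltr_wpDl.
(* [M] is the squared distance between the images of [p] and [p0]. This [t] gives [t * M < 2 * a],
   so moving from [p0] towards [p] would decrease the norm. *)
pose t := a / (M + a).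
have t0 : 0 < t by rewrite divr_gt0.
have tMa : t * (M + a) = a by rewrite divfK ?gt_eqF.
have t1 : t <= 1 by rewrite ler_pdivrMr // mul1r lerDr.
have := key t; rewrite ltW // t1 => /(_ isT).
rewrite -subr_ge0 (_ : _ - _ = t * (t * M - 2 * a)); last by rewrite /M /a; ring.
rewrite pmulr_rge0 // => h.
have : t * a > 0 by rewrite mulr_gt0.
by move: tMa h; rewrite mulrDr; lra.
Qed.

End Compactness.

(** * Approximation on the extreme boundary of a Bauer simplex *)

Section ConeOver.
Variables (R : realType) (E : lmodType R) (K : set E).
Hypothesis K0 : K !=set0.
Hypothesis convK : forall x y (t : R), K x -> K y -> 0 <= t <= 1 ->
  K (t *: x + (1 - t) *: y).
Local Notation C := (cone_over K).

Lemma convex_comb2 x y (a b : R) : K x -> K y -> 0 <= a -> 0 <= b ->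
  exists2 z, K z & (a + b) *: z = a *: x + b *: y.
Proof.
move=> Kx Ky a0 b0; have [ab0|abn0] := eqVneq (a + b) 0.
  have [-> ->] : a = 0 /\ b = 0 by split; lra.
  by exists x => //; rewrite addr0 !scale0r addr0.
have ab0 : 0 < a + b by rewrite lt_neqAle eq_sym abn0 addr_ge0.
exists (a / (a + b) *: x + (1 - a / (a + b)) *: y).
  apply: convK => //; rewrite divr_ge0 ?addr_ge0 //=.
  by rewrite ler_pdivrMr // mul1r lerDl.
rewrite scalerDr !scalerA; congr (_ *: _ + _ *: _); first by field.
by field.
Qed.

Lemma cone_over_base x : K x -> C (x, 1).
Proof. by move=> Kx; exists 1, x; rewrite scale1r. Qed.

Lemma cone_over0 : C 0.
Proof. by have [x Kx] := K0; exists 0, x; split=> //; rewrite scale0r. Qed.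

Lemma cone_overD u v : C u -> C v -> C (u + v).
Proof.
move=> [r [x [r0 Kx ->]]] [s [y [s0 Ky ->]]].
have [z Kz zE] := convex_comb2 Kx Ky r0 s0.
by exists (r + s), z; split; rewrite ?addr_ge0 // zE.
Qed.

Lemma cone_overZ (a : R) u : 0 <= a -> C u -> C (a *: u).
Proof.
move=> a0 [r [x [r0 Kx ->]]]; exists (a * r), x; split; rewrite ?mulr_ge0 //.
by rewrite -scalerA.
Qed.

Lemma cone_overN u : C u -> C (- u) -> u = 0.
Proof.
move=> [r [x [r0 Kx ->]]] [s [y [s0 Ky [_ rs]]]].
have -> : r = 0 by lra.
by rewrite scale0r.
Qed.

End ConeOver.

(** The extension of [g] from the base to the cone, homogeneous of degree one; at height 0 the
    factor [z.2] makes it 0. *)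
Definition homogenize (R : realType) (E : lmodType R) (g : E -> R)
  (z : E * R^o) : R := z.2 * g (z.2^-1 *: z.1).

Lemma homogenizeE (R : realType) (E : lmodType R) (g : E -> R) (r : R) x :
  homogenize g (r *: x, r) = r * g x.
Proof.
rewrite /homogenize /=; have [->|r0] := eqVneq r 0; first by rewrite !mul0r.
by rewrite scalerA mulVf // scale1r.
Qed.

Lemma homogenizeZ (R : realType) (E : lmodType R) (g : E -> R) (a : R) z :
  homogenize g (a *: z) = a * homogenize g z.
Proof.
rewrite /homogenize /=; have [->|a0] := eqVneq a 0.
  by rewrite !scale0r !mul0r.
rewrite -mulrA; congr (_ * (_ * g _)).
rewrite scalerA; congr (_ *: _).
by rewrite /GRing.scale /= invfM mulrAC mulVf // mul1r.
Qed.

(* [t] is within [e] of the integral of [g] against the measure on the extreme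
   points that [z] represents in the simplex [K]. *)
Definition near_integral (R : realType) (E : lmodType R) (K : set E)
    (g : E -> R) (e : R) (z : E * R^o) (t : R) : Prop :=
  exists n (d : nat -> E * R^o),
    [/\ forall i, (i < n)%N -> cone_over K (d i), \sum_(i < n) d i = z &
      forall m (w : nat -> nat -> E * R^o),
        (forall i j, (i < n)%N -> (j < m)%N -> cone_over K (w i j)) ->
        (forall i, (i < n)%N -> \sum_(j < m) w i j = d i) ->
        `|t - \sum_(i < n) \sum_(j < m) homogenize g (w i j)| <= e * z.2].

(** * Near integrals: convexity and uniqueness *)

Section NearIntegral.
Variables (R : realType) (E : lmodType R) (K : set E) (g : E -> R).
Hypothesis K0 : K !=set0.
Hypothesis convK : forall x y (t : R), K x -> K y -> 0 <= t <= 1 ->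
  K (t *: x + (1 - t) *: y).
Local Notation C := (cone_over K).

(** The two decompositions are juxtaposed; a refinement of the result restricts to a refinement of
    each. *)
Lemma near_integralD e z t z' t' : near_integral K g e z t ->
  near_integral K g e z' t' -> near_integral K g e (z + z') (t + t').
Proof.
move=> [n [d [Cd dz dP]]] [n' [d' [Cd' dz' dP']]].
exists (n + n')%N, (fun i => if (i < n)%N then d i else d' (i - n)%N); split.
- move=> i ilt; case: ltnP => [|ni]; first exact: Cd.
  by apply: Cd'; rewrite ltn_subLR.
- rewrite big_split_ord /= -dz -dz'; congr (_ + _); apply: eq_bigr => i _.
    by rewrite ltn_ord.
  by rewrite /= ltnNge leq_addr addKn.
move=> m w Cw wd; rewrite big_split_ord /=.
have h1 : `|t - \sum_(i < n) \sum_(j < m) homogenize g (w i j)| <= e * z.2.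
  apply: dP => [i j ilt jm|i ilt]; first by apply: Cw => //; rewrite ltn_addr.
  by have := wd i; rewrite ilt ltn_addr //; exact.
have h2 : `|t' - \sum_(i < n') \sum_(j < m) homogenize g (w (n + i)%N j)|
    <= e * z'.2.
  apply: (dP' _ (fun i => w (n + i)%N)) => [i j ilt jm|i ilt].
    by apply: Cw => //; rewrite ltn_add2l.
  have := wd (n + i)%N; rewrite ltn_add2l ilt ltnNge leq_addr addKn /=; exact.
rewrite mulrDr (le_trans _ (lerD h1 h2)) // (le_trans _ (ler_normD _ _)) //.
by rewrite opprD addrACA.
Qed.

Lemma near_integralZ e z t (a : R) : 0 <= a -> near_integral K g e z t ->
  near_integral K g e (a *: z) (a * t).
Proof.
move=> a0 [n [d [Cd dz dP]]].
(* Refinements will be rescaled by [a^-1]; for [a = 0] the empty decomposition serves instead. *)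
have [->|an0] := eqVneq a 0.
  exists 0%N, d; split=> // [|m w _ _].
    by rewrite big_ord0 scale0r.
  by rewrite big_ord0 mul0r subr0 normr0 scale0r mulr0.
exists n, (fun i => a *: d i); split.
- by move=> i ilt; apply: cone_overZ => //; exact: Cd.
- by rewrite -scaler_sumr dz.
move=> m w Cw wd.
have ai : 0 <= a^-1 by rewrite invr_ge0.
have /(_ m (fun i j => a^-1 *: w i j)) := dP.
have -> : e * (a *: z).2 = a * (e * z.2) by rewrite /GRing.scale /= mulrCA.
move=> h; rewrite -ler_pdivrMl ?lt_neqAle ?a0 1?eq_sym ?an0 //.
rewrite -{1}(ger0_norm ai) -normrM mulrBr mulKf // mulr_sumr.
under eq_bigr => i _ do rewrite mulr_sumr.
under eq_bigr => i _ do under eq_bigr => j _ do rewrite -homogenizeZ.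
apply: h => [i j ilt jm|i ilt]; first by apply: cone_overZ => //; exact: Cw.
by rewrite -scaler_sumr wd // scalerA mulVf // scale1r.
Qed.

(** The Riemann sum of a common refinement, given by [riesz_matrix], is close to both values. *)
Lemma near_integral_uniq e z t t' : lattice_cone C ->
  near_integral K g e z t -> near_integral K g e z t' ->
  `|t - t'| <= 2 * e * z.2.
Proof.
move=> lattC [n [d [Cd dz dP]]] [n' [d' [Cd' dz' dP']]].
have [|w [Cw wd wd']] := riesz_matrix (cone_over0 K0) (cone_overD convK)
  (@cone_overN _ _ K) lattC Cd Cd'; first by rewrite dz dz'.
have h := dP _ _ Cw wd.
have /(_ n (fun i j => w j i)) h' := dP'.
have {h'} h' : `|t' - \sum_(j < n') \sum_(i < n) homogenize g (w i j)| <= e * z.2.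
  by apply: h' => [i j ilt jm|//]; exact: Cw.
rewrite exchange_big /= in h'.
set S := \sum_(i < n) _ in h h'.
have -> : t - t' = (t - S) - (t' - S) by ring.
by rewrite (le_trans (ler_normB _ _)) //; lra.
Qed.

End NearIntegral.

Lemma convex_set_comb (R : realType) (E : lmodType R) (K : set E) :
  convex_set (K : set (convex_lmodType E)) ->
  forall x y (t : R), K x -> K y -> 0 <= t <= 1 -> K (t *: x + (1 - t) *: y).
Proof.
move=> cK x y t Kx Ky /andP[t0 t1].
by have := cK x y (Itv01 t0 t1); rewrite !inE; apply.
Qed.

(** Select the terms of one sign, then those of the other. *)
Lemma sum_norm_le2 (R : realDomainType) m (v : nat -> R) (e : R) :
  (forall Q : pred nat, `|\sum_(j < m | Q j) v j| <= e) ->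
  \sum_(j < m) `|v j| <= 2 * e.
Proof.
move=> ve; rewrite (bigID (fun j : 'I_m => 0 <= v j)) /=.
rewrite mulrDl mul1r lerD //.
  apply: le_trans (ve (fun j => 0 <= v j)); apply: le_trans (ler_norm _).
  by apply: ler_sum => j vj; rewrite ger0_norm.
apply: le_trans (ve (fun j => ~~ (0 <= v j))).
rewrite -normrN -sumrN; apply: le_trans (ler_norm _).
by apply: ler_sum => j; rewrite -ltNge => vj; rewrite ltr0_norm.
Qed.

(** * Estimates near an extreme point *)

Section LocalEstimate.
Variables (R : realType) (E : preTopologicalLmodType R).
Variables (I : Type) (c : I -> E -> R) (K : set E).
Hypothesis cD : forall i x y, c i (x + y) = c i x + c i y.
Hypothesis cZ : forall i (a : R) x, c i (a *: x) = a * c i x.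
Hypothesis c_cont : forall i, continuous (c i).
Hypothesis c_sep : forall x y, (forall i, c i x = c i y) -> x = y.
Hypothesis cptK : compact K.
Hypothesis convK : forall x y (t : R), K x -> K y -> 0 <= t <= 1 ->
  K (t *: x + (1 - t) *: y).
Local Notation C := (cone_over K).
Local Notation Ext := (extreme_points K).

Definition near_coord (s : seq I) (e x : E) : R :=
  \sum_(i <- s) `|c i x - c i e|.

Lemma near_coord_continuous s e : continuous (near_coord s e).
Proof.
apply: (continuous_sum_seq (D := fun i x => `|c i x - c i e|)) => i x.
by apply: cvg_norm; apply: cvgB; [exact: c_cont|exact: cvg_cst].
Qed.

(** Write [u = (r *: y, r)] and [v = ((1 - r) *: y', 1 - r)]. On the compact set of triples
    [(y, y', r)] that violate the bound, extremality of [e] excludes [r *: y + (1 - r) *: y' = e],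
    so finitely many coordinates keep this point at a positive distance from [e]. *)
Lemma cone_decomposition_small s e (h : R) : Ext e -> 0 < h ->
  exists (s' : seq I) (d : R), 0 < d /\
    forall x, K x -> near_coord s' e x < d ->
    forall u v, C u -> C v -> u + v = (x, 1) ->
    \sum_(i <- s) `|c i u.1 - u.2 * c i e| <= h.
Proof.
move=> [Ke ext_e] h0.
pose f (p : E * E * R) := \sum_(i <- s) `|p.2 * (c i p.1.1 - c i e)|.
have c1 i : continuous (fun p : E * E * R => c i p.1.1).
  move=> p; apply: (@cvg_comp _ _ _ (fun p : E * E * R => p.1.1) (c i)).
    by apply: cvg_comp; exact: cvg_fst.
  exact: c_cont.
have c2 i : continuous (fun p : E * E * R => c i p.1.2).
  move=> p; apply: (@cvg_comp _ _ _ (fun p : E * E * R => p.1.2) (c i)).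
    by apply: cvg_comp; [exact: cvg_fst|exact: cvg_snd].
  exact: c_cont.
have c3 : continuous (fun p : E * E * R => p.2) by move=> p; exact: cvg_snd.
have cf : continuous f.
  pose F i (p : E * E * R) := `|p.2 * (c i p.1.1 - c i e)|.
  apply: (continuous_sum_seq (D := F)) => i p.
  apply: cvg_norm; apply: cvgM; first exact: c3.
  by apply: cvgB; [exact: c1|exact: cvg_cst].
pose P := (K `*` K `*` `[0, 1]) `&` [set p | h <= f p].
have cptP : compact P.
  apply: compact_closedI.
    by apply: compact_setX; [exact: compact_setX|exact: segment_compact].
  apply: (@closed_comp _ _ f [set y | h <= y]) => [p _|]; first exact: cf.
  exact: closed_ge.
pose D i (p : E * E * R) := p.2 * c i p.1.1 + (1 - p.2) * c i p.1.2 - c i e.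
have [i p|[[x y] t] [[[/= Kx Ky]]]|s' [d [d0 s'd]]] :=
  compact_finite_sep cptP (D := D).
- apply: cvgB; last exact: cvg_cst.
  apply: cvgD; first by apply: cvgM; [exact: c3|exact: c1].
  apply: cvgM; last exact: c2.
  by apply: cvgB; [exact: cvg_cst|exact: c3].
- rewrite in_itv /= => t01 hf; apply: contrapT => /forallNP D0.
  have eE : e = t *: x + (1 - t) *: y.
    apply: c_sep => i; have /negP := D0 i; rewrite negbK /D /= subr_eq0 cD !cZ.
    by move/eqP.
  have xe : t = 0 \/ x = e.
    have [->|tn0] := eqVneq t 0; [by left|right].
    have [t1|tn1] := eqVneq t 1; first by rewrite eE t1 subrr scale0r scale1r addr0.
    suff t01' : 0 < t < 1 by have [-> _] := ext_e x y t Kx Ky t01' eE.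
    by rewrite !lt_neqAle eq_sym tn0 tn1.
  move: hf; rewrite /f /= big1 ?leNgt ?h0 // => i _.
  by case: xe => ->; rewrite ?mul0r ?subrr ?mulr0 normr0.
exists s', d; split=> // x Kx xd u v Cu Cv uv.
rewrite leNgt; apply/negP => hu; move: xd; rewrite ltNge => /negP; apply.
move: Cu Cv uv hu => [r [y [r0 Ky ->]]] [r' [y' [r'0 Ky' ->]]] [xE rr] /= hu.
have rE : r' = 1 - r by rewrite -rr addrC addKr.
have /= := s'd ((y, y'), r); rewrite /near_coord -xE rE.
under [X in _ -> _ <= X]eq_bigr => i _ do rewrite cD !cZ.
apply; split=> /=; first by rewrite in_itv /=; split=> //; rewrite r0 -rr lerDl.
rewrite /f /= (le_trans (ltW hu)) // le_eqVlt; apply/orP; left; apply/eqP.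
by apply: eq_bigr => i _; rewrite cZ mulrBr.
Qed.

(** Where [g] differs from [g e] by at least [h], [near_coord] has a positive lower bound, so a
    large multiple of it dominates the maximum of the difference on [K]. *)
Lemma continuous_estimate (g : E -> R) e (h : R) : continuous g -> K e -> 0 < h ->
  exists (s : seq I) (B : R), 0 <= B /\
    forall x, K x -> `|g x - g e| <= h + B * near_coord s e x.
Proof.
move=> cg Ke h0.
have cgN : continuous (fun x => `|g x - g e|).
  by move=> x; apply: cvg_norm; apply: cvgB; [exact: cg|exact: cvg_cst].
have cptP : compact (K `&` [set x | h <= `|g x - g e|]).
  apply: compact_closedI => //.
  apply: (@closed_comp _ _ _ [set y | h <= y]) => [p _|]; first exact: cgN.
  exact: closed_ge.
have [i x|x [Kx hx]|s [d [d0 sd]]] :=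
  compact_finite_sep cptP (D := fun i x => c i x - c i e).
- by apply: cvgB; [exact: c_cont|exact: cvg_cst].
- apply: contrapT => /forallNP D0; move: hx; rewrite /= (_ : x = e).
    by rewrite subrr normr0 leNgt h0.
  apply: c_sep => i; apply/eqP; rewrite -subr_eq0.
  by have /negP := D0 i; rewrite negbK.
have KN : K !=set0 by exists e.
have [x0 _ x0max] := compact_EVT_max KN cptK (continuous_subspaceT cgN).
exists s, (`|g x0 - g e| / d); split; first by rewrite divr_ge0 // ltW.
move=> x Kx; have n0 : 0 <= near_coord s e x by apply: sumr_ge0.
have [hx|/ltW hx] := leP h `|g x - g e|; last first.
  by rewrite (le_trans hx) // lerDl mulr_ge0 // divr_ge0 // ltW.
rewrite (le_trans (x0max x _)) ?inE //.
rewrite (@le_trans _ _ (`|g x0 - g e| / d * near_coord s e x)) //.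
  by rewrite -mulrA ler_peMr // ler_pdivlMl // mulr1; exact: sd.
by rewrite lerDr ltW.
Qed.

(** All partial sums of the pieces are almost multiples of [(e, 1)], hence the deviations of the
    pieces are small in total; [continuous_estimate], scaled by the height of each piece, then
    bounds the error. *)
Lemma refinement_sum_near (g : E -> R) e (h : R) : continuous g -> Ext e -> 0 < h ->
  exists (s : seq I) (d : R), 0 < d /\
    forall x, K x -> near_coord s e x < d ->
    forall m (w : nat -> E * R^o), (forall j, (j < m)%N -> C (w j)) ->
    \sum_(j < m) w j = (x, 1) ->
    `|g e - \sum_(j < m) homogenize g (w j)| <= h.
Proof.
move=> cg ext_e h0; have Ke : K e by case: ext_e.
have KN : K !=set0 by exists e.
have h2 : 0 < h / 2 by rewrite divr_gt0.
have [s [B [B0 sB]]] := continuous_estimate cg Ke h2.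
(* Chosen to make [B * (2 * (size s)%:R * k)] at most [h / 2]; the summand 1 keeps the denominator
   positive. *)
pose k := h / 2 / (2 * (size s)%:R * B + 1).
have den0 : 0 < 2 * (size s)%:R * B + 1 by rewrite ltr_wpDl // !mulr_ge0.
have k0 : 0 < k by rewrite divr_gt0.
have [s' [d [d0 s'd]]] := cone_decomposition_small s ext_e k0.
exists s', d; split=> // x Kx xd m w Cw wx.
have w21 : \sum_(j < m) (w j).2 = 1.
  by have := congr1 snd wx; rewrite raddf_sum.
pose v i j := c i (w j).1 - (w j).2 * c i e.
(* The pieces in [Q] and those outside it sum to a decomposition of [(x, 1)] into two cone
   elements. *)
have part (Q : pred nat) : \sum_(i <- s) `|\sum_(j < m | Q j) v i j| <= k.
  have CQ (Q' : pred nat) : C (\sum_(j < m | Q' j) w j).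
    apply: cone_sum => [|z1 z2|j _]; [exact: cone_over0|exact: cone_overD|exact: Cw].
  have := s'd x Kx xd _ _ (CQ Q) (CQ (predC Q)).
  rewrite -wx [RHS](bigID (fun j : 'I_m => Q j)) /= => /(_ erefl).
  apply: le_trans.
  rewrite le_eqVlt; apply/orP; left; apply/eqP; apply: eq_bigr => i _.
  rewrite !raddf_sum /= mulr_suml sumrB; congr (`|_ - _|).
  have c0 : c i 0 = 0 by rewrite -(scale0r 0) cZ mul0r.
  by rewrite (big_morph (c i) (cD i) c0).
have sumk : \sum_(j < m) \sum_(i <- s) `|v i j| <= 2 * (size s)%:R * k.
  rewrite exchange_big /= big_tnth.
  have -> : 2 * (size s)%:R * k = \sum_(l < size s) 2 * k.
    by rewrite sumr_const card_ord -mulr_natr; ring.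
  apply: ler_sum => l _.
  apply: sum_norm_le2 => Q.
  apply: le_trans (part Q); rewrite [X in _ <= X]big_tnth (bigD1 l) //= lerDl.
  by apply: sumr_ge0.
have Gle j : (j < m)%N -> `|(w j).2 * g e - homogenize g (w j)| <=
    (w j).2 * (h / 2) + B * \sum_(i <- s) `|v i j|.
  move=> /Cw [r [y [r0 Ky wE]]]; rewrite /v wE /= homogenizeE -mulrBr normrM ger0_norm //.
  rewrite distrC (le_trans (ler_wpM2l r0 (sB y Ky))) // mulrDr lerD2l mulrCA.
  rewrite ler_wpM2l // mulr_sumr ler_sum // => i _.
  by rewrite cZ -mulrBr normrM ger0_norm.
have -> : g e = \sum_(j < m) (w j).2 * g e by rewrite -mulr_suml w21 mul1r.
rewrite -sumrB (le_trans (ler_norm_sum _ _ _)) //.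
apply: le_trans
  (_ : \sum_(j < m) ((w j).2 * (h / 2) + B * \sum_(i <- s) `|v i j|) <= h).
  by apply: ler_sum => j _; exact: Gle.
rewrite big_split /= -mulr_suml w21 mul1r -mulr_sumr.
have : B * (2 * (size s)%:R * k) <= h / 2.
  have -> : B * (2 * (size s)%:R * k) =
      h / 2 * (2 * (size s)%:R * B / (2 * (size s)%:R * B + 1)).
    by rewrite /k; field; rewrite gt_eqF.
  by rewrite ler_piMr ?(ltW h2) // ler_pdivrMr // mul1r lerDl.
have := ler_wpM2l B0 sumk; lra.
Qed.

Lemma near_integral_extreme (g : E -> R) e (h : R) :
  continuous g -> Ext e -> 0 < h ->
  exists (s : seq I) (d : R), 0 < d /\
    forall x, K x -> near_coord s e x < d -> near_integral K g h (x, 1) (g e).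
Proof.
move=> cg ext_e h0; have [s [d [d0 sd]]] := refinement_sum_near cg ext_e h0.
exists s, d; split=> // x Kx xd; exists 1%N, (fun=> (x, 1)); split.
- by move=> *; exact: cone_over_base.
- by rewrite big_ord1.
move=> m w Cw wx; rewrite big_ord1 mulr1; apply: (sd x) => //; last exact: wx.
by move=> j jm; exact: Cw.
Qed.

End LocalEstimate.

(** Uncurried, so that joint continuity in endpoints and parameter concerns a single map. *)
Definition segment_point (R : realType) (E : lmodType R) (q : E * E * R) : E :=
  q.2 *: q.1.1 + (1 - q.2) *: q.1.2.

(** For nonempty convex [A] and [B] this is the convex hull of their union; as an image of a product
    it inherits compactness. *)
Definition convex_join (R : realType) (E : lmodType R) (A B : set E) : set E :=
  @segment_point R E @` (A `*` B `*` `[0, 1]).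

(** Collect the contributions of [A] and of [B] separately and merge each with [convex_comb2], which
    allows total weight 0. *)
Lemma convex_join_convex (R : realType) (E : lmodType R) (A B : set E) :
  (forall x y (t : R), A x -> A y -> 0 <= t <= 1 -> A (t *: x + (1 - t) *: y)) ->
  (forall x y (t : R), B x -> B y -> 0 <= t <= 1 -> B (t *: x + (1 - t) *: y)) ->
  forall x y (t : R), convex_join A B x -> convex_join A B y -> 0 <= t <= 1 ->
    convex_join A B (t *: x + (1 - t) *: y).
Proof.
move=> cA cB _ y t [[[a b] r] [[/= Aa Bb]]] r01 <-.
move=> [[[a' b'] r'] [[/= Aa' Bb']]] r'01 <-.
move: r01 r'01; rewrite /= !in_itv /= => /andP[r0 r1] /andP[r'0 r'1] /andP[t0 t1].
have t1' : 0 <= 1 - t by lra.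
have [a'' Aa'' aE] := convex_comb2 cA Aa Aa' (mulr_ge0 t0 r0) (mulr_ge0 t1' r'0).
have r_ge0 : 0 <= 1 - r by lra.
have r'_ge0 : 0 <= 1 - r' by lra.
have [b'' Bb'' bE] := convex_comb2 cB Bb Bb' (mulr_ge0 t0 r_ge0) (mulr_ge0 t1' r'_ge0).
exists ((a'', b''), t * r + (1 - t) * r').
  split=> //=; rewrite in_itv /= addr_ge0 ?mulr_ge0 //=.
  have := ler_wpM2l t0 r1; have := ler_wpM2l t1' r'1; lra.
rewrite /segment_point /= aE.
have -> : 1 - (t * r + (1 - t) * r') = t * (1 - r) + (1 - t) * (1 - r') by ring.
by rewrite bE !scalerDr !scalerA addrACA.
Qed.

Lemma convex_joinl (R : realType) (E : lmodType R) (A B : set E) :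
  B !=set0 -> A `<=` convex_join A B.
Proof.
move=> [b Bb] a Aa; exists ((a, b), 1).
  by split=> //=; rewrite in_itv /= ler01 lexx.
by rewrite /segment_point /= subrr scale0r scale1r addr0.
Qed.

Lemma convex_joinr (R : realType) (E : lmodType R) (A B : set E) :
  A !=set0 -> B `<=` convex_join A B.
Proof.
move=> [a Aa] b Bb; exists ((a, b), 0).
  by split=> //=; rewrite in_itv /= ler01 lexx.
by rewrite /segment_point /= subr0 scale0r scale1r add0r.
Qed.

(** * The approximate graph and its separation *)

Section Bauer.
Variables (R : realType) (E : preTopologicalLmodType R).
Variables (I : Type) (c : I -> E -> R) (K : set E).
Hypothesis cD : forall i x y, c i (x + y) = c i x + c i y.
Hypothesis cZ : forall i (a : R) x, c i (a *: x) = a * c i x.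
Hypothesis c_cont : forall i, continuous (c i).
Hypothesis c_sep : forall x y, (forall i, c i x = c i y) -> x = y.
Hypothesis segment_cont : continuous (@segment_point R E).
Hypothesis bauerK : bauer_simplex K.
Local Notation Ext := (extreme_points K).

Lemma segment_point_prod_continuous :
  continuous (@segment_point R (E * R^o)%type).
Proof.
move=> p; pose f1 (q : E * R^o * (E * R^o) * R) := segment_point (q.1.1.1, q.1.2.1, q.2).
pose f2 (q : E * R^o * (E * R^o) * R) : R^o := q.2 * q.1.1.2 + (1 - q.2) * q.1.2.2.
have c11 : (fun q : E * R^o * (E * R^o) * R => q.1.1) @ p --> p.1.1.
  by apply: cvg_comp; exact: cvg_fst.
have c12 : (fun q : E * R^o * (E * R^o) * R => q.1.2) @ p --> p.1.2.
  by apply: cvg_comp; [exact: cvg_fst|exact: cvg_snd].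
have c2 : (fun q : E * R^o * (E * R^o) * R => q.2) @ p --> p.2 by exact: cvg_snd.
have c111 : (fun q : E * R^o * (E * R^o) * R => q.1.1.1) @ p --> p.1.1.1.
  by exact: (@cvg_comp _ _ _ _ fst _ _ _ c11 (@cvg_fst _ _ _ _ _)).
have c121 : (fun q : E * R^o * (E * R^o) * R => q.1.2.1) @ p --> p.1.2.1.
  by exact: (@cvg_comp _ _ _ _ fst _ _ _ c12 (@cvg_fst _ _ _ _ _)).
have cf1 : f1 @ p --> f1 p.
  apply: (@cvg_comp _ _ _ (fun q : E * R^o * (E * R^o) * R => (q.1.1.1, q.1.2.1, q.2))
    (@segment_point R E) _ (nbhs (p.1.1.1, p.1.2.1, p.2))); last exact: segment_cont.
  exact: (cvg_pair (cvg_pair c111 c121) c2).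
have cf2 : f2 @ p --> f2 p.
  apply: cvgD; apply: cvgM => //.
  - by exact: (@cvg_comp _ _ _ _ snd _ _ _ c11 (@cvg_snd _ _ _ _ _)).
  - by apply: cvgB => //; exact: cvg_cst.
  - by exact: (@cvg_comp _ _ _ _ snd _ _ _ c12 (@cvg_snd _ _ _ _ _)).
exact: (cvg_pair cf1 cf2).
Qed.

Lemma near_coord_convex (s : seq I) e (d : R) x y (t : R) : 0 <= t <= 1 ->
  near_coord c s e x <= d -> near_coord c s e y <= d ->
  near_coord c s e (t *: x + (1 - t) *: y) <= d.
Proof.
move=> /andP[t0 t1] xd yd; have t1' : 0 <= 1 - t by lra.
have : near_coord c s e (t *: x + (1 - t) *: y) <=
    t * near_coord c s e x + (1 - t) * near_coord c s e y.
  rewrite !mulr_sumr -big_split /=; apply: ler_sum => i _.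
  rewrite (_ : c i _ - c i e = t * (c i x - c i e) + (1 - t) * (c i y - c i e)).
    by rewrite (le_trans (ler_normD _ _)) // !normrM (ger0_norm t0) (ger0_norm t1').
  by rewrite cD !cZ; ring.
have := ler_wpM2l t0 xd; have := ler_wpM2l t1' yd; lra.
Qed.

(** Local pieces are a compact convex neighbourhood times one value. Two pieces are merged by
    [convex_join], on which near integrals persist by [near_integralD] and [near_integralZ]. *)
Lemma near_integral_hull (g : E -> R) (h : R) : continuous g -> 0 < h ->
  exists H : set (E * R^o), [/\ compact H,
    forall x y (t : R), H x -> H y -> 0 <= t <= 1 -> H (t *: x + (1 - t) *: y),
    forall x, H x -> K x.1 /\ near_integral K g h (x.1, 1) x.2 &
    forall e, Ext e -> exists t, H (e, t)].
Proof.
move=> cg h0; have [[cptK cvxK lattK] closedExt] := bauerK.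
have convK := convex_set_comb cvxK.
have cptExt : compact Ext.
  by apply: (subclosed_compact closedExt cptK) => x [].
apply: (@compact_local_global _ Ext (fun A => exists H : set (E * R^o), [/\ compact H,
    forall x y (t : R), H x -> H y -> 0 <= t <= 1 -> H (t *: x + (1 - t) *: y),
    forall x, H x -> K x.1 /\ near_integral K g h (x.1, 1) x.2 &
    forall e, A e -> exists t, H (e, t)]) cptExt).
- by exists set0; split=> //; exact: compact0.
- by move=> A B AB [H [? ? ? BH]]; exists H; split=> // e /AB; exact: BH.
- move=> A B [H [cptH cvxH Hn HA]] [H' [cptH' cvxH' H'n H'B]].
  (* A join with the empty set is empty, so empty pieces are treated apart. *)
  have [H0|/set0P H0] := eqVneq H set0.
    exists H'; split=> // e [/HA[t]|]; last exact: H'B.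
    by rewrite H0.
  have [H'0|/set0P H'0] := eqVneq H' set0.
    exists H; split=> // e [|/H'B[t]]; first exact: HA.
    by rewrite H'0.
  exists (convex_join H H'); split.
  + apply: continuous_compact.
      exact/continuous_subspaceT/segment_point_prod_continuous.
    by apply: compact_setX; [exact: compact_setX|exact: segment_compact].
  + exact: convex_join_convex.
  + move=> _ [[[[x t] [y t']] r] [[/= /Hn[/= Kx nx] /H'n[/= Ky ny]]]] r01 <-.
    move: r01; rewrite /= in_itv /= => r01; split; first exact: convK.
    have /andP[r0 r1] := r01; have r1' : 0 <= 1 - r by lra.
    have := near_integralD (near_integralZ r0 nx) (near_integralZ r1' ny).
    congr near_integral; congr (_, _).
    by change (r * 1 + (1 - r) * 1 = 1 :> R); ring.
  + move=> e [/HA|/H'B] [t Ht]; exists t; [exact: convex_joinl|exact: convex_joinr].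
move=> e ext_e; have Ke : K e by case: ext_e.
have [s [d [d0 sd]]] :=
  near_integral_extreme cD cZ c_cont c_sep cptK convK cg ext_e h0.
have cs := @near_coord_continuous _ _ _ c c_cont s e.
(* Halving [d] fits a closed neighbourhood inside the strict bound [d]. *)
exists [set x | near_coord c s e x < d / 2].
  apply: (cvgr_lt (near_coord c s e e) (cs e)).
  rewrite /near_coord big1 ?divr_gt0 // => i _.
  by rewrite subrr normr0.
exists ((K `&` [set x | near_coord c s e x <= d / 2]) `*` [set g e]); split.
- apply: compact_setX; last exact: compact_set1.
  apply: compact_closedI => //.
  apply: (@closed_comp _ _ _ [set y | y <= d / 2]) => [p _|]; first exact: cs.
  exact: closed_le.
- move=> [x r] [y r'] t [/= [Kx xd] ->] [/= [Ky yd] ->] t01; split=> /=.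
    by split; [exact: convK|exact: near_coord_convex].
  by rewrite /GRing.scale /=; ring.
- move=> [x t] [[/= Kx xd] ->]; split=> //; apply: sd => //.
  by rewrite (le_lt_trans xd) // ltr_pdivrMr // ltr_pMr // ltr1n.
- move=> x [[Kx _] xd]; exists (g e); split=> //=; split=> //; exact: ltW.
Qed.

(** [None] will index the value coordinate of the graph; its repetitions are collected in [b]. *)
Lemma sum_option_split (s : seq (option I)) (a : option I -> R) :
  exists (s' : seq I) (b : R), forall F : option I -> R,
    \sum_(o <- s) a o * F o = \sum_(i <- s') a (Some i) * F (Some i) + b * F None.
Proof.
elim: s => [|[i|] s [s' [b IHs]]].
- by exists [::], 0 => F; rewrite !big_nil mul0r addr0.
- by exists (i :: s'), b => F; rewrite !big_cons IHs addrA.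
- by exists s', (a None + b) => F; rewrite big_cons IHs mulrDl addrCA.
Qed.

Theorem bauer_approximation (g : E -> R) (h : R) : continuous g -> 0 < h ->
  exists (s : seq I) (a : I -> R) (b : R), forall e, Ext e ->
    `|g e - (b + \sum_(i <- s) a i * c i e)| <= h.
Proof.
move=> cg h0; have [[cptK cvxK lattK] closedExt] := bauerK.
have convK := convex_set_comb cvxK.
have [->|/set0P[e0 ext0]] := eqVneq Ext set0; first by exists [::], (fun=> 0), 0.
have KN : K !=set0 by exists e0; case: ext0.
(* The final error is [7 * k]: twice [2 * k] from [HEg] and [3 * k] from the shift in [D]. *)
pose k := h / 8; have k0 : 0 < k by rewrite divr_gt0.
have [H [cptH cvxH Hn HE]] := near_integral_hull cg k0.
have uniqH x t t' : H (x, t) -> H (x, t') -> `|t - t'| <= 2 * k.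
  move=> /Hn[_ /= nt] /Hn[_ /= nt']; rewrite -[leRHS]mulr1.
  exact: (near_integral_uniq KN convK lattK nt nt').
(* [H] may have several values above [e], but [g e] is itself a near integral at [(e, 1)]. *)
have HEg e t : Ext e -> H (e, t) -> `|t - g e| <= 2 * k.
  move=> ext_e /Hn[_ /= nt]; rewrite -[leRHS]mulr1.
  apply: (near_integral_uniq KN convK lattK nt).
  have [s [d [d0 sd]]] :=
    near_integral_extreme cD cZ c_cont c_sep cptK convK cg ext_e k0.
  apply: sd; first by case: ext_e.
  by rewrite /near_coord big1 // => i _; rewrite subrr normr0.
(* Where the points agree, [uniqH] bounds the difference of values by [2 * k], so the shift by
   [3 * k] keeps [D] from vanishing. *)
pose D (o : option I) (p : (E * R^o) * (E * R^o)) : R :=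
  if o is Some i then c i p.1.1 - c i p.2.1 else p.1.2 - p.2.2 - 3 * k.
have cptP : compact (H `*` H) by exact: compact_setX.
have [[i|] p|p Pp|p q t [/= Hp1 Hp2] [/= Hq1 Hq2] t01|s [a sa]] :=
  compact_convex_sep cptP (D := D).
- apply: cvgB.
    apply: (@cvg_comp _ _ _ (fun p : E * R^o * (E * R^o) => p.1.1) (c i)).
      by apply: cvg_comp; exact: cvg_fst.
    exact: c_cont.
  apply: (@cvg_comp _ _ _ (fun p : E * R^o * (E * R^o) => p.2.1) (c i)).
    by apply: cvg_comp; [exact: cvg_snd|exact: cvg_fst].
  exact: c_cont.
- apply: cvgB; last exact: cvg_cst.
  apply: cvgB.
    by apply: cvg_comp; [exact: cvg_fst|exact: cvg_snd].
  by apply: cvg_comp; exact: cvg_snd.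
- apply: contrapT => /forallNP D0.
  case: p Pp D0 => -[x t] [y t'] [/= Hx Hy] D0.
  have xy : x = y.
    apply: c_sep => i; apply/eqP; rewrite -subr_eq0.
    by have /negP := D0 (Some i); rewrite negbK.
  rewrite -xy in Hy; have := uniqH _ _ _ Hx Hy.
  have /negP := D0 None; rewrite negbK /D /= => /eqP.
  move=> tt'; rewrite (_ : t - t' = 3 * k); last by lra.
  by rewrite ger0_norm; lra.
- exists (t *: p + (1 - t) *: q); first by split=> /=; exact: cvxH.
  case=> [i|] /=; rewrite /D /=.
    by rewrite !cD !cZ; ring.
  by rewrite /GRing.scale /=; ring.
have [s' [b sE]] := sum_option_split s a.
have HP x y : H x -> H y ->
    0 < \sum_(i <- s') a (Some i) * (c i x.1 - c i y.1) + b * (x.2 - y.2 - 3 * k).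
  by move=> Hx Hy; have := sa (x, y) (conj Hx Hy); rewrite sE.
have [t0 Ht0] := HE _ ext0.
(* On the diagonal only the shift survives, which fixes the sign of [b]; so one may divide by
   [- b]. *)
have b0 : b < 0.
  have := HP _ _ Ht0 Ht0; rewrite big1 ?add0r /=; last by move=> i _; rewrite subrr mulr0.
  rewrite subrr sub0r mulrN oppr_gt0 => bk; rewrite ltNge; apply/negP => b0.
  by move: bk; rewrite ltNge mulr_ge0 // mulr_ge0 // ltW.
pose f e := \sum_(i <- s') (- b)^-1 * a (Some i) * c i e.
have fle e e' : Ext e -> Ext e' -> g e - g e' - 7 * k <= f e - f e'.
  move=> ext_e ext_e'; have [t Ht] := HE _ ext_e; have [t' Ht'] := HE _ ext_e'.
  have := HEg _ _ ext_e Ht; have := HEg _ _ ext_e' Ht'.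
  rewrite !ler_norml => /andP[_ h1] /andP[h2 _].
  have := HP _ _ Ht Ht'; rewrite /= -(ltr_pM2l (x := (- b)^-1)) ?invr_gt0 ?oppr_gt0 //.
  rewrite mulr0 mulrDr [X in _ + X](_ : _ = - (t - t' - 3 * k)); last first.
    by field; rewrite lt_eqF.
  suff -> : (- b)^-1 * (\sum_(i <- s') a (Some i) * (c i e - c i e')) = f e - f e' by lra.
  by rewrite /f -sumrB mulr_sumr; apply: eq_bigr => i _; ring.
(* By [fle] in both directions [g - f] is nearly constant on [Ext]; the constant is its value at
   [e0]. *)
exists s', (fun i => (- b)^-1 * a (Some i)), (g e0 - f e0) => e ext_e.
rewrite -/(f e); have := fle _ _ ext_e ext0; have := fle _ _ ext0 ext_e.
by rewrite ler_norml /k; lra.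
Qed.

End Bauer.

(** * Types and formulas *)

Section TypeSpace.
Variables (R : realType) (L : language R) (n : nat).
Local Notation I := (affine_formula L n).
Local Notation W phi := (initial_topology (fun f : type_space L n => f phi : R^o)).

Lemma type_eval_continuous (phi : I) :
  continuous (fun p : type_space L n => p phi).
Proof.
move=> p A Ap.
have /cvg_sup/(_ phi) : p --> p by exact: cvg_id.
apply; exact: (@initial_continuous _ _ (fun f : I -> R^o => f phi) p A Ap).
Qed.

Lemma type_cvg (X : Type) (F : set_system X) (FF : Filter F)
    (f : X -> type_space L n) (p : type_space L n) :
  (forall phi, (fun x => f x phi) @ F --> p phi) -> f @ F --> p.
Proof.
move=> fp; apply/cvg_sup => phi A [B [[U oU <-] Up] /filterS]; apply.
by apply: fp; exact: open_nbhs_nbhs.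
Qed.

Lemma type_segment_continuous : continuous (@segment_point R (type_space L n)).
Proof.
move=> q; apply: type_cvg => phi.
have ev (f : type_space L n * type_space L n * R -> type_space L n) :
    f @ q --> f q -> (fun q => f q phi) @ q --> f q phi.
  move=> fq; apply: (@cvg_comp _ _ _ f (fun p : type_space L n => p phi) _ _ _ fq).
  exact: type_eval_continuous.
have c2 : (fun q : type_space L n * type_space L n * R => q.2) @ q --> q.2.
  exact: cvg_snd.
apply: (@cvgD R R^o); apply: (@cvgM R).
- exact: c2.
- by apply: (ev (fun q => q.1.1)); apply: cvg_comp; exact: cvg_fst.
- by apply: cvgB; [exact: cvg_cst|exact: c2].
- by apply: (ev (fun q => q.1.2)); apply: cvg_comp; [exact: cvg_fst|exact: cvg_snd].
Qed.

End TypeSpace.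

(** * Continuity of connectives *)

Section ContinuousMaps.
Variables (R : realType).

Lemma row_continuous (X : topologicalType) k (f : 'I_k -> X -> R) :
  (forall i, continuous (f i)) -> continuous (fun x => \row_i f i x).
Proof.
move=> cf x A [P MP PA].
have : \forall y \near x, forall j : 'I_k, P ord0 j (f j y).
  apply: filter_forall => j; apply: cf.
  by have := MP ord0 j; rewrite mxE.
apply: filterS => y Py; apply: PA => i j; rewrite mxE ord1; exact: Py.
Qed.

(** Only [x] is confined to [A]: [y] will be a row of approximating values, which may leave the
    box. *)
Lemma compact_uniform_modulus k (u : 'rV[R]_k -> R) (A : set 'rV[R]_k) (e : R) :
  continuous u -> compact A -> 0 < e ->
  exists d : R, 0 < d /\ forall x y, A x -> ball x d y -> `|u x - u y| <= e.
Proof.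
move=> cu cA e0.
apply: (@compact_local_global _ A (fun B => exists d : R, 0 < d /\
   forall x y, B x -> ball x d y -> `|u x - u y| <= e)) => //.
- by exists 1; split.
- by move=> B B' BB' [d [d0 dP]]; exists d; split=> // x y /BB'; exact: dP.
- move=> B B' [d [d0 dP]] [d' [d'0 dP']]; exists (Num.min d d'); split.
    by rewrite lt_min d0.
  move=> x y [Bx|B'x] xy; [apply: dP|apply: dP'] => //.
    by apply: le_ball xy; rewrite ge_min lexx.
  by apply: le_ball xy; rewrite ge_min lexx orbT.
move=> x Ax; have e2 : 0 < e / 2 by rewrite divr_gt0.
have ux : nbhs x [set y | `|u x - u y| <= e / 2].
  exact: (cvgr_dist_le u (u x) (cu x) _ e2).
have [r /= r0 rP] := (nbhs_ballP _ _).1 ux.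
exists (ball x (r / 2)); first by apply: nbhsx_ballx; rewrite divr_gt0.
exists (r / 2); split; first by rewrite divr_gt0.
move=> y z [_ xy] yz.
have h1 : `|u x - u y| <= e / 2.
  by apply: rP; apply: le_ball xy; lra.
have h2 : `|u x - u z| <= e / 2.
  by apply: rP; rewrite (splitr r); exact: ball_triangle yz.
have -> : u y - u z = (u x - u z) - (u x - u y) by ring.
by rewrite (le_trans (ler_normB _ _)) //; lra.
Qed.

Lemma box_compact k (B : 'I_k -> R) :
  compact [set v : 'rV[R]_k | forall i, `[- B i, B i]%classic (v ord0 i)].
Proof.
apply: (rV_compact (A := fun i => `[- B i, B i]%classic)) => i.
exact: segment_compact.
Qed.

Lemma affine_continuous k (u : 'rV[R]_k -> R) :
  affine_connectives u -> continuous_connectives u.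
Proof.
move=> [c [a uE]]; rewrite /continuous_connectives /=.
have -> : u = fun x => c + \sum_i a i * x ord0 i by exact/funext.
have cs : continuous (fun x : 'rV[R]_k => \sum_i a i * x ord0 i).
  apply: (continuous_sum_seq (D := fun i (x : 'rV[R]_k) => a i * x ord0 i)) => i x.
  exact: (cvgM (cvg_cst (a i)) (@coord_continuous R 1 k ord0 i x)).
by move=> x; exact: (cvgD (cvg_cst c) (cs x)).
Qed.

End ContinuousMaps.

(** * Suprema and infima of bounded functions *)

Section SupInf.
Variables (R : realType) (X : Type) (x0 : X).

Lemma has_sup_range (f : X -> R) B : (forall x, `|f x| <= B) ->
  has_sup (range f).
Proof.
move=> fB; split; first by exists (f x0), x0.
by exists B => _ [x _ <-]; exact: le_trans (ler_norm _) (fB x).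
Qed.

(** The bound [B] guards against the default value of [sup] on unbounded sets. *)
Lemma sup_range_le (f : X -> R) B r : (forall x, `|f x| <= B) ->
  (sup (range f) <= r <-> forall x, f x <= r).
Proof.
move=> fB; split=> [fr x|fr]; last first.
  by apply: ge_sup; [exists (f x0), x0|move=> _ [x _ <-]].
by apply: le_trans fr; apply: sup_upper_bound; [exact: has_sup_range fB|exists x].
Qed.

Lemma sup_range_dist (f g : X -> R) B B' e :
  (forall x, `|f x| <= B) -> (forall x, `|g x| <= B') ->
  (forall x, `|f x - g x| <= e) -> `|sup (range f) - sup (range g)| <= e.
Proof.
move=> fB gB fg; rewrite ler_norml.
have /(sup_range_le _ fB) : forall x, f x <= sup (range g) + e.
  move=> x; have := fg x; rewrite ler_norml => /andP[_].
  by have := (sup_range_le _ gB).1 (lexx _) x; lra.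
have /(sup_range_le _ gB) : forall x, g x <= sup (range f) + e.
  move=> x; have := fg x; rewrite ler_norml => /andP[+ _].
  by have := (sup_range_le _ fB).1 (lexx _) x; lra.
by lra.
Qed.

Lemma inf_range (f : X -> R) : inf (range f) = - sup (range (fun x => - f x)).
Proof. by rewrite /inf image_comp. Qed.

Lemma sup_range_norm (f : X -> R) B : (forall x, `|f x| <= B) ->
  `|sup (range f)| <= B.
Proof.
move=> fB; have fb x : - B <= f x <= B by rewrite -ler_norml.
rewrite ler_norml; apply/andP; split.
  have := (sup_range_le _ fB).1 (lexx _) x0; apply: le_trans.
  by case/andP: (fb x0).
by apply/(sup_range_le _ fB) => x; case/andP: (fb x).
Qed.

Lemma inf_range_norm (f : X -> R) B : (forall x, `|f x| <= B) ->
  `|inf (range f)| <= B.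
Proof.
by move=> fB; rewrite inf_range normrN; apply: sup_range_norm => x; rewrite normrN.
Qed.

Lemma inf_range_dist (f g : X -> R) B B' e :
  (forall x, `|f x| <= B) -> (forall x, `|g x| <= B') ->
  (forall x, `|f x - g x| <= e) -> `|inf (range f) - inf (range g)| <= e.
Proof.
move=> fB gB fg.
rewrite !inf_range -opprD normrN.
apply: (sup_range_dist (B := B) (B' := B')) => x; rewrite ?normrN //.
by rewrite -opprD normrN.
Qed.

End SupInf.

Lemma extend_eta (X : Type) n (a : 'I_n.+1 -> X) :
  extend (a ord0) (fun i => a (lift ord0 i)) = a.
Proof. by apply/funext => i; rewrite /extend; case: unliftP => [j|] ->. Qed.

(** * Bounds and closures of formulas *)

Section Formulas.
Variables (R : realType) (L : language R).

(** The bound is uniform over all structures: by induction the arguments of a connective range over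
    a fixed compact box. *)
Lemma feval_bounded (C : connectives R) n (phi : formula L C n) :
  (forall k (u : 'rV[R]_k -> R), C k u -> continuous u) ->
  exists B : R, forall (M : structure L) (a : 'I_n -> M), `|feval phi a| <= B.
Proof.
move=> contC; elim: phi => {n} [n s t|n P s|n k u Cu psi IH|n psi [B IH]|n psi [B IH]].
- by exists (diam L) => M a /=; rewrite ger0_norm ?mdist_ge0 // mdist_diam.
- by exists (pbound P) => M a; exact: pint_bound.
- have [B BP] := choice IH.
  have : bounded_set (u @` [set v : 'rV[R]_k |
      forall i, `[- B i, B i]%classic (v ord0 i)]).
    apply/compact_bounded/continuous_compact; last exact: box_compact.
    exact/continuous_subspaceT/contC.
  move=> /ex_strict_bound_gt0[r _ ur]; exists r => M a /=.
  apply/ltW/ur; exists (\row_i feval (psi i) a) => // i /=.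
  by rewrite mxE in_itv /= -ler_norml.
- exists B => M a /=; have [x0] := carrier_inhabited M.
  by apply: (sup_range_norm x0) => x; exact: IH.
- exists B => M a /=; have [x0] := carrier_inhabited M.
  by apply: (inf_range_norm x0) => x; exact: IH.
Qed.

Lemma continuous_formula_bounded n (phi : continuous_formula L n) :
  exists B : R, forall (M : structure L) (a : 'I_n -> M), `|feval phi a| <= B.
Proof. exact: feval_bounded. Qed.

Lemma affine_formula_bounded n (phi : affine_formula L n) :
  exists B : R, forall (M : structure L) (a : 'I_n -> M), `|feval phi a| <= B.
Proof. by apply: feval_bounded => k u /affine_continuous. Qed.

Fixpoint map_connectives (C C' : connectives R)
    (CC' : forall k (u : 'rV[R]_k -> R), C k u -> C' k u)
    n (phi : formula L C n) : formula L C' n :=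
  match phi in formula _ _ n return formula L C' n with
  | Dist n s t => Dist C' s t
  | Pred n P s => Pred C' s
  | Conn n k u Cu psi => Conn (CC' k u Cu) (fun i => map_connectives CC' (psi i))
  | Sup n psi => Sup (map_connectives CC' psi)
  | Inf n psi => Inf (map_connectives CC' psi)
  end.

Lemma feval_map_connectives (C C' : connectives R)
    (CC' : forall k (u : 'rV[R]_k -> R), C k u -> C' k u)
    n (phi : formula L C n) (M : structure L) (a : 'I_n -> M) :
  feval (map_connectives CC' phi) a = feval phi a.
Proof.
elim: phi a => {n} [n s t|n P s|n k u Cu psi IH|n psi IH|n psi IH] a //=.
- by congr u; apply/rowP => i; rewrite !mxE.
- by under [in RHS]eq_fun => x do rewrite -IH.
- by under [in RHS]eq_fun => x do rewrite -IH.
Qed.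

Definition affine_to_continuous n : affine_formula L n -> continuous_formula L n :=
  map_connectives (@affine_continuous R) (n := n).

Fixpoint sup_closure (C : connectives R) n : formula L C n -> formula L C 0 :=
  if n is n'.+1 then fun phi => sup_closure (Sup phi) else id.

Lemma sup_closure_le n (phi : continuous_formula L n) (M : structure L) r :
  (forall a : 'I_0 -> M, feval (sup_closure phi) a <= r) <->
  (forall a : 'I_n -> M, feval phi a <= r).
Proof.
elim: n phi => [//|n IHn] phi /=; rewrite IHn /=.
have [B phiB] := continuous_formula_bounded phi.
have [x0] := carrier_inhabited M.
have fB (b : 'I_n -> M) x : `|feval phi (extend x b)| <= B by exact: phiB.
split=> phir a; last by apply/(sup_range_le x0 r (fB a)).
have := (sup_range_le x0 r (fB (fun i => a (lift ord0 i)))).1 (phir _) (a ord0).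
by rewrite extend_eta.
Qed.

End Formulas.

(** * Extremal models of a Bauer theory *)

Section BauerTheory.
Variables (R : realType) (L : language R) (T : affine_theory L).

(** Closing under [Sup] turns the bound for all tuples into a single condition, which then belongs
    to the theory. *)
Lemma extremal_theory_universal n (phi : continuous_formula L n) (r : R) :
  (forall (M : structure L) (a : 'I_n -> M),
    extremal_model T M -> feval phi a <= r) ->
  forall (M : structure L) (a : 'I_n -> M),
    is_model (extremal_theory T) M -> feval phi a <= r.
Proof.
move=> phir M a TM.
(* The constant [r] is a connective of arity 0; any formula can fill its empty family of
   arguments. *)
have cst_cont : @continuous_connectives R 0 (fun=> r) by exact: cst_continuous.
pose c : condition L (@continuous_connectives R) :=
  (sup_closure phi, Conn cst_cont (fun=> sup_closure phi)).
have Tc : extremal_theory T c.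
  by move=> N TN; apply: (sup_closure_le phi N r).2 => b; exact: phir.
exact: (sup_closure_le phi M r).1 (TM c Tc) a.
Qed.

Lemma extremal_theory_model (M : structure L) :
  is_model (extremal_theory T) M -> is_model T M.
Proof.
move=> TM c Tc a.
have := TM (affine_to_continuous c.1, affine_to_continuous c.2) _ a.
rewrite /= !feval_map_connectives; apply=> N [TN _] b /=.
by rewrite !feval_map_connectives; exact: TN.
Qed.

Hypothesis hT : bauer_theory T.

(** Apply [bauer_approximation] to the type space, with evaluation at affine formulas as
    coordinates: the affine combination obtained is again an affine formula. *)
Lemma affine_formula_approximation n k (psi : 'I_k -> affine_formula L n)
    (u : 'rV[R]_k -> R) (e : R) : continuous u -> 0 < e ->
  exists chi : affine_formula L n,
    forall (M : structure L) (a : 'I_n -> M), extremal_model T M ->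
      `|u (\row_i feval (psi i) a) - feval chi a| <= e.
Proof.
move=> cu e0.
pose c (phi : affine_formula L n) (p : type_space L n) : R := p phi.
pose g (p : type_space L n) := u (\row_i p (psi i)).
have cg : continuous g.
  move=> p; pose r (p : type_space L n) := \row_i p (psi i).
  apply: (@cvg_comp _ _ _ r u); last exact: cu.
  apply: (@row_continuous R _ k (fun i (p : type_space L n) => p (psi i))) => i.
  exact: type_eval_continuous.
have cD phi x y : c phi (x + y) = c phi x + c phi y by [].
have cZ phi (r : R) x : c phi (r *: x) = r * c phi x by [].
have c_sep x y : (forall phi, c phi x = c phi y) -> x = y by move=> xy; apply/funext.
have [s [w [b sP]]] := bauer_approximation cD cZ (@type_eval_continuous R L n) c_sep
  (@type_segment_continuous R L n) (hT n) cg e0.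
pose v (x : 'rV[R]_(size s)) := b + \sum_i w (tnth (in_tuple s) i) * x ord0 i.
have av : affine_connectives v by exists b, (fun i => w (tnth (in_tuple s) i)).
exists (Conn av (tnth (in_tuple s))) => M a [_ /(_ n a) extM].
have := sP _ extM; congr (`|_ - (_ + _)| <= _).
by rewrite big_tnth; apply: eq_bigr => i _; rewrite mxE.
Qed.

(** A connective costs [e / 2] for replacing its arguments and [e / 2] for replacing itself. A
    quantifier costs nothing, as it ranges over the same extremal model. *)
Lemma extremal_affine_reduction n (phi : continuous_formula L n) (e : R) : 0 < e ->
  exists psi : affine_formula L n,
    forall (M : structure L) (a : 'I_n -> M), extremal_model T M ->
      `|feval phi a - feval psi a| <= e.
Proof.
elim: phi e => {n} [n s t|n P s|n k u Cu psi IH|n psi IH|n psi IH] e e0.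
- by exists (Dist _ s t) => M a _; rewrite subrr normr0 ltW.
- by exists (Pred _ s) => M a _; rewrite subrr normr0 ltW.
- have e2 : 0 < e / 2 by rewrite divr_gt0.
  have [B BP] := choice (fun i => continuous_formula_bounded (psi i)).
  have [d [d0 dP]] := compact_uniform_modulus Cu (@box_compact R k B) e2.
  have d2 : 0 < d / 2 by rewrite divr_gt0.
  have [chi chiP] := choice (fun i => IH i _ d2).
  have [chi' chi'P] := affine_formula_approximation chi Cu e2.
  exists chi' => M a TM /=.
  have h1 : `|u (\row_i feval (psi i) a) - u (\row_i feval (chi i) a)| <= e / 2.
    apply: dP => [i|]; first by rewrite /= mxE in_itv /= -ler_norml.
    split=> // i j; rewrite !mxE -ball_normE /=.
    by rewrite (le_lt_trans (chiP _ _ _ TM)) // ltr_pdivrMr // ltr_pMr // ltr1n.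
  have h2 := chi'P _ a TM.
  rewrite (splitr e) (le_trans _ (lerD h1 h2)) // (le_trans _ (ler_normD _ _)) //.
  by rewrite addrA subrK.
- have [chi chiP] := IH e e0; exists (Sup chi) => M a TM /=.
  have [x0] := carrier_inhabited M.
  have [B psiB] := continuous_formula_bounded psi.
  have [B' chiB] := affine_formula_bounded chi.
  by apply: (sup_range_dist x0 (B := B) (B' := B')) => x //; exact: chiP.
- have [chi chiP] := IH e e0; exists (Inf chi) => M a TM /=.
  have [x0] := carrier_inhabited M.
  have [B psiB] := continuous_formula_bounded psi.
  have [B' chiB] := affine_formula_bounded chi.
  by apply: (inf_range_dist x0 (B := B) (B' := B')) => x //; exact: chiP.
Qed.

Lemma extremal_theory_affine_reduction : affine_reduction (extremal_theory T).
Proof.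
move=> n phi e e0; have [psi psiP] := extremal_affine_reduction phi e0.
exists psi => M a TM.
(* The distance of [phi] and [psi] is made one formula, whose upper bound passes to all models of
   the theory. *)
pose u (x : 'rV[R]_2) := `|x ord0 ord0 - x ord0 ord_max|.
have cu : @continuous_connectives R 2 u.
  have cB : continuous (fun x : 'rV[R]_2 => x ord0 ord0 - x ord0 ord_max).
    move=> x; exact: (cvgB (@coord_continuous R 1 2 ord0 ord0 x)
      (@coord_continuous R 1 2 ord0 ord_max x)).
  by move=> x; exact: (cvg_norm (cB x)).
pose f (i : 'I_2) := if i == ord0 then phi else affine_to_continuous psi.
have fE (N : structure L) (b : 'I_n -> N) :
    feval (Conn cu f) b = `|feval phi b - feval psi b|.
  by rewrite /= /u !mxE /f /= feval_map_connectives.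
rewrite -fE; apply: extremal_theory_universal TM => N b TN.
by rewrite fE; exact: psiP.
Qed.

Lemma nonextreme_type_separated n (p : type_space L n) :
  ~ extreme_points (affine_types T n) p ->
  exists (s : seq (affine_formula L n)) (d : R), 0 < d /\
    forall q, extreme_points (affine_types T n) q ->
      d <= \sum_(phi <- s) `|q phi - p phi|.
Proof.
move=> next; have [[cptK _ _] closedExt] := hT n.
have cptExt : compact (extreme_points (affine_types T n)).
  by apply: (subclosed_compact closedExt cptK) => x [].
apply: (compact_finite_sep cptExt
    (D := fun phi (q : type_space L n) => q phi - p phi)) => [phi q|q extq].
  exact: (cvgB (@type_eval_continuous _ _ _ phi q) (cvg_cst (p phi))).
apply: contrapT => /forallNP D0; apply: next; rewrite (_ : p = q) //.
apply/funext => phi; apply/esym/eqP; rewrite -subr_eq0.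
by have /negP := D0 phi; rewrite negbK.
Qed.

Lemma extremal_theory_extremal_model (M : structure L) :
  is_model (extremal_theory T) M -> extremal_model T M.
Proof.
move=> TM; have TM' := extremal_theory_model TM; split=> // n a.
apply: contrapT => /nonextreme_type_separated[s [d [d0 sd]]].
move pE : (affine_type a) sd => p sd.
pose k := size s; pose f (i : 'I_k) := affine_to_continuous (tnth (in_tuple s) i).
(* The values of [p] enter as real constants, and the sign turns the lower bound [d] into a
   transferable upper bound. At [a] itself the sum is 0. *)
pose u (x : 'rV[R]_k) := - \sum_i `|x ord0 i - p (tnth (in_tuple s) i)|.
have cu : @continuous_connectives R k u.
  pose F i (x : 'rV[R]_k) := `|x ord0 i - p (tnth (in_tuple s) i)|.
  have cF : continuous (fun x => \sum_i F i x).
    apply: continuous_sum_seq => i x.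
    exact: (cvg_norm (cvgB (@coord_continuous R 1 k ord0 i x) (cvg_cst _))).
  by move=> x; exact: (cvgN (cF x)).
have fE (N : structure L) (b : 'I_n -> N) :
    feval (Conn cu f) b = - \sum_(phi <- s) `|affine_type b phi - p phi|.
  rewrite /= /u big_tnth; congr (- _); apply: eq_bigr => i _.
  by rewrite mxE feval_map_connectives.
have : feval (Conn cu f) a <= - d.
  apply: extremal_theory_universal TM => N b [_ /(_ n b) extN].
  by rewrite fE lerN2; exact: sd.
rewrite fE big1 ?oppr0 ?oppr_ge0 ?leNgt ?d0 // => phi _.
by rewrite pE subrr normr0.
Qed.

End BauerTheory.

Theorem theorem15p7 (R : realType) (L : language R) (T : affine_theory L)
    (hT : bauer_theory T) :
  affine_reduction (extremal_theory T) /\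
  (forall M : structure L,
     is_model (extremal_theory T) M <-> extremal_model T M).
Proof.
split; first exact: extremal_theory_affine_reduction.
move=> M; split; first exact: extremal_theory_extremal_model.
by move=> TM c; apply.
Qed.
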